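(* Assume the inner approximation property stated in the context. Let $w\in\operatorname{dom}\varphi$ and let $\varepsilon>0$. Then the stationarity-test procedure (stated in the context), run at $w$ with tolerance $\varepsilon$, stops after finitely many inner iterations. Termination by the first (stationarity) test guarantees $\chi(w)\le\varepsilon$. Termination by the second (relative) test guarantees $$\chi(w)>c_\sigma\varepsilon,\qquad c_\sigma=\frac{1-\sigma}{1+\sigma}>0 .$$ Moreover, at any requested $t>0$ with $p(w;t)\ne0$, the relative test alone succeeds after finitely many inner iterations; that is, for the pairs $(y^j,\mu^j)$ and tested bounds $\overline{\mathcal G}_j$ produced for the request $(w,t)$, there is a finite $j$ with $\overline{\mathcal G}_j\le\frac{\sigma^2}{2t}\|y^j-w\|_W^2$.
   Context: $W$ is a real Hilbert space with inner product $(\cdot,\cdot)_W$; $X$ is a real Banach space with continuous dual $X^*$; $T:W\to X$ is bounded and linear with Banach adjoint $T^*:X^*\to W^*$. $\|\ell\|_{W^*}=\|\mathcal R_W^{-1}\ell\|_W$ with $\mathcal R_W:W\to W^*$ the Riesz map. $R:X\to(-\infty,+\infty]$ is proper, convex, norm lower semicontinuous; $\varphi=R\circ T$, $\operatorname{dom}\varphi\ne\emptyset$. $f:W\to\mathbb R$ is continuously Fréchet differentiable with Hilbert gradient $\nabla f$ (i.e. $(\nabla f(w),v)_W=f'(w)[v]$) globally Lipschitz with constant $L_f\ge0$; $F=f+\varphi$ is bounded below on $\operatorname{dom}\varphi$ by a finite $F_{\rm low}$. Fixed parameters: $\tau>0$, $0<\sigma<1$. $p(w;t)=\arg\min_{s\in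 W}\{(\nabla f(w),s)_W+\frac1{2t}\|s\|_W^2+\varphi(w+s)\}$ (unique), and $\chi(w)=\frac1\tau\|p(w;\tau)\|_W$. For $q\in W$, $t>0$: $\Psi_{q,t}(y)=\frac1{2t}\|y-q\|_W^2+R(Ty)$, $D_{q,t}(\mu)=\langle\mu,Tq\rangle-\frac t2\|T^*\mu\|_{W^*}^2-R^*(\mu)$, $R^*(\mu)=\sup_{x\in X}(\langle\mu,x\rangle-R(x))$, gap $\mathcal G_{q,t}(y,\mu)=\Psi_{q,t}(y)-D_{q,t}(\mu)$, finite when $Ty\in\operatorname{dom}R$, $\mu\in\operatorname{dom}R^*$. Inner approximation property: for every requested $w\in\operatorname{dom}\varphi$ and $t>0$, with $q=w-t\nabla f(w)$, the inner procedure produces a sequence of pairs $(y^j,\mu^j)\in W\times X^*$ with finite gaps and $\mathcal G_{q,t}(y^j,\mu^j)\to0$, together with available numbers $\overline{\mathcal G}_j\ge\mathcal G_{q,t}(y^j,\mu^j)$, $\overline{\mathcal G}_j\to0$, used in all tests ($\overline{\mathcal G}_j$ is either the gap itself or a rigorous upper bound for it). Stationarity-test procedure at $w$ with tolerance $\varepsilon>0$: take $t=\tau$, $q=w-\tau\nabla f(w)$ and generate the pairs above. At each pair: (i) if $U_\tau(y^j,\mu^j;w):=\frac{\|y^j-w\|_W}{\tau}+\sqrt{2\overline{\mathcal G}_j/\tau}\le\varepsilon$, stop (first test); (ii) otherwise, if $\overline{\mathcal G}_j\le\frac{\sigma^2}{2\tau}\|y^j-w\|_W^2$, stop (second, relative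 test). Otherwise pass to $j+1$. One inner iteration is one generated pair. *)

(* Defs.v *)
From HB Require Import structures.
From mathcomp Require Import all_boot all_order all_algebra.
From mathcomp Require Import sesquilinear.
From mathcomp Require Import all_classical all_reals all_analysis.

Set Implicit Arguments.
Unset Strict Implicit.
Unset Printing Implicit Defensive.

Import Order.TTheory GRing.Theory Num.Theory.
Import numFieldNormedType.Exports.

Local Open Scope classical_set_scope.
Local Open Scope ring_scope.

(* A real Hilbert space is a [completeNormedModType] W over a [realType] K with
   a positive definite symmetric form [ip : {dot W for idfun}] that induces its
   norm. *)
Definition induces_norm (K : realType) (W : completeNormedModType K)
    (ip : {dot W for idfun}) : Prop :=
  forall w : W, ip w w = `|w| ^+ 2.

Record bounded_linear (K : realType) (V U : normedModType K) := BoundedLinear {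
  bounded_linear_fun :> {linear V -> U} ;
  bounded_linearP : bounded_near bounded_linear_fun (nbhs 0) }.

Record dual (K : realType) (V : normedModType K) := Dual {
  dual_fun :> {linear V -> K^o} ;
  dual_continuous : continuous dual_fun }.

Lemma adjoint_continuous (K : realType) (V U : normedModType K)
    (T : bounded_linear V U) (mu : dual U) : continuous (mu \o T).
Proof.
move=> v; apply: continuous_comp; last exact: dual_continuous.
exact/bounded_linear_continuous/bounded_linearP.
Qed.

Definition adjoint (K : realType) (V U : normedModType K)
    (T : bounded_linear V U) (mu : dual U) : dual V :=
  @Dual K V (mu \o T : {linear V -> K^o}) (@adjoint_continuous K V U T mu).

Section Hilbert.
Context {K : realType} {W : completeNormedModType K}.
Variable ip : {dot W for idfun}.

(* The inverse of the Riesz map v |-> (v, .); by the Riesz representation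
   theorem the default value 0 is not used when W is a Hilbert space. *)
Definition riesz_inv (l : dual W) : W := xget 0 [set v | forall u, ip v u = l u].

Definition hdual_norm (l : dual W) : K := `|riesz_inv l|.

(* The differential is continuous as a map into the dual with its operator
   norm. *)
Definition continuously_differentiable (f : W -> K^o) : Prop :=
  (forall w, differentiable f w) /\
  forall w (e : K), 0 < e ->
    \forall w' \near w, forall v, `|'d f w' v - 'd f w v| <= e * `|v|.

Definition is_gradient (f : W -> K^o) (gradf : W -> W) : Prop :=
  forall w v, ip (gradf w) v = 'd f w v.

End Hilbert.

Section ExtendedValued.
Context {K : realType}.
Local Open Scope ereal_scope.

Definition edom (V : Type) (g : V -> \bar K) : set V := [set v | g v < +oo].

Definition eproper (V : Type) (g : V -> \bar K) : Prop :=
  (forall v, g v != -oo) /\ edom g !=set0.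

Definition econvex (V : lmodType K) (g : V -> \bar K) : Prop :=
  forall (u v : V) (a : K), (0 < a < 1)%R ->
    g (a *: u + (1 - a) *: v)%R <= a%:E * g u + (1 - a)%:E * g v.

Definition conjugate (X : normedModType K) (R : X -> \bar K) (mu : dual X) :
  \bar K := ereal_sup [set (mu x)%:E - R x | x in [set: X]].

End ExtendedValued.

Section Proximal.
Context {K : realType} {W : completeNormedModType K}.
Variables (ip : {dot W for idfun}) (gradf : W -> W) (phi : W -> \bar K).

Definition prox_objective (w : W) (t : K) (s : W) : \bar K :=
  ((ip (gradf w) s + (2 * t)^-1 * `|s| ^+ 2)%:E + phi (w + s)%R)%E.

Definition is_argmin (g : W -> \bar K) (s : W) : Prop :=
  forall s', (g s <= g s')%E.

(* For t > 0 and phi proper, convex and lower semicontinuous, there is exactly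
   one minimizer, so that the default value 0 is not used. *)
Definition prox_step (w : W) (t : K) : W :=
  xget 0 [set s | is_argmin (prox_objective w t) s].

Definition chi (tau : K) (w : W) : K := tau^-1 * `|prox_step w tau|.

End Proximal.

Section Gap.
Context {K : realType} {W X : completeNormedModType K}.
Variables (ip : {dot W for idfun}) (T : bounded_linear W X) (R : X -> \bar K).

Definition primal (q : W) (t : K) (y : W) : \bar K :=
  (((2 * t)^-1 * `|y - q| ^+ 2)%:E + R (T y))%E.

Definition dual_objective (q : W) (t : K) (mu : dual X) : \bar K :=
  ((mu (T q) - t / 2 * hdual_norm ip (adjoint T mu) ^+ 2)%:E
   - conjugate R mu)%E.

Definition gap (q : W) (t : K) (y : W) (mu : dual X) : \bar K :=
  (primal q t y - dual_objective q t mu)%E.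

(* The inner procedure is modelled by its output: [y w t j], [mu w t j] and
   [G w t j] are the j-th pair and the j-th available gap bound produced for
   the request (w, t). *)
Definition inner_approximation (gradf : W -> W) (y : W -> K -> nat -> W)
    (mu : W -> K -> nat -> dual X) (G : W -> K -> nat -> K) : Prop :=
  forall (w : W) (t : K), edom (R \o T) w -> 0 < t ->
    let q := w - t *: gradf w in
    [/\ forall j, gap q t (y w t j) (mu w t j) \is a fin_num,
        gap q t (y w t j) (mu w t j) @[j --> \oo] --> 0%E,
        forall j, (gap q t (y w t j) (mu w t j) <= (G w t j)%:E)%E &
        G w t j @[j --> \oo] --> (0 : K)].

End Gap.

Section StationarityTest.
Context {K : realType} {W : completeNormedModType K}.

Definition stationarity_bound (tau : K) (w y : W) (G : K) : K :=
  `|y - w| / tau + Num.sqrt (2 * G / tau).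

Definition relative_test (sigma t : K) (w y : W) (G : K) : bool :=
  G <= sigma ^+ 2 / (2 * t) * `|y - w| ^+ 2.

Variant verdict := StopFirst | StopSecond | Continue.

Definition test_pair (tau sigma eps : K) (w y : W) (G : K) : verdict :=
  if stationarity_bound tau w y G <= eps then StopFirst
  else if relative_test sigma tau w y G then StopSecond
  else Continue.

Section Run.
Variables (tau sigma eps : K) (w : W) (y : nat -> W) (G : nat -> K).

Definition continues_before (j : nat) : Prop :=
  forall i, (i < j)%N -> test_pair tau sigma eps w (y i) (G i) = Continue.

(* The pairs are numbered from 0: stopping at index j takes j + 1 inner
   iterations. *)
Definition stops_first (j : nat) : Prop :=
  continues_before j /\ test_pair tau sigma eps w (y j) (G j) = StopFirst.

Definition stops_second (j : nat) : Prop :=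
  continues_before j /\ test_pair tau sigma eps w (y j) (G j) = StopSecond.

End Run.

Definition c_sigma (sigma : K) : K := (1 - sigma) / (1 + sigma).

End StationarityTest.

(* Main.v *)
Require Import Defs.
From mathcomp Require Import all_boot all_order all_algebra.
From mathcomp Require Import sesquilinear ring lra.
From mathcomp Require Import all_classical all_reals all_analysis.
Import Order.TTheory GRing.Theory Num.Theory.
Import numFieldNormedType.Exports.
Local Open Scope classical_set_scope.
Local Open Scope ring_scope.

(** Write Psi for the proximal objective at the request (w, t), that is,
    y |-> |y - q|^2 / (2t) + R (T y) with q = w - t grad f(w).  It differs from
    the objective defining p(w; t) by the shift s = y - w and an additive
    constant, so that its minimizer is y* = w + p(w; t).  Two facts tie the
    computable gap bound to the distance from y*.

    - Weak duality: the dual objective never exceeds Psi.  It combines the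
      Fenchel inequality, Young's inequality and the Riesz representation of
      T^* mu ([riesz_representation], [weak_duality]).  Hence Psi(y^j) exceeds
      inf Psi by at most the gap, and so by at most the tested bound G_j.
    - Psi is strongly convex with modulus 1/t, so it grows quadratically away
      from its minimizer ([quadratic_growth]).

    Together they give |y^j - y*|^2 <= 2 t G_j ([gap_error_bound]), and so
    |y^j - w| differs from |p(w; t)| by at most sqrt (2 t G_j)
    ([step_length_error]).  The rest is arithmetic with this estimate.  The first
    test bounds |p| / tau directly.  If the second test succeeds while the first
    fails, then with D = |y^j - w| the error is at most sigma D, so
    |p| >= (1 - sigma) D and (1 + sigma) D > eps tau.  For termination, G_j -> 0
    forces |y^j - w| -> |p|: if p = 0 the left side of the first test tends
    to 0, and if p <> 0 the left side of the relative test tends to 0 while its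
    right side stays away from 0.

    The minimizer exists because, by weak duality, the pairs themselves form a
    minimizing sequence.  Such a sequence is Cauchy by strong convexity and its
    limit is a minimizer by lower semicontinuity
    ([minimizing_sequence_argmin]).  The same argument, applied to
    v |-> |v|^2 / 2 - l v, gives the Riesz representation theorem. *)

(** * Identities for the norm of a Hilbert space *)

Section HilbertGeometry.
Context {K : realType} {W : completeNormedModType K} {ip : {dot W for idfun}}.
Hypothesis ip_norm : induces_norm ip.

Lemma ip_sym (u v : W) : ip u v = ip v u.
Proof. by rewrite hermC expr0 mul1r. Qed.

Lemma ipZl (a : K) (u v : W) : ip (a *: u) v = a * ip u v.
Proof. exact: linearZl_LR. Qed.

Lemma ipZr (a : K) (u v : W) : ip u (a *: v) = a * ip u v.
Proof. exact: linearZr_LR. Qed.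

Lemma sqr_normD (u v : W) : `|u + v| ^+ 2 = `|u| ^+ 2 + 2 * ip u v + `|v| ^+ 2.
Proof.
rewrite -!ip_norm linearDl !linearDr/= (ip_sym v u); ring.
Qed.

Lemma sqr_normB (u v : W) : `|u - v| ^+ 2 = `|u| ^+ 2 - 2 * ip u v + `|v| ^+ 2.
Proof. by rewrite sqr_normD linearNr normrN mulrN. Qed.

Lemma sqr_normZ (a : K) (u : W) : `|a *: u| ^+ 2 = a ^+ 2 * `|u| ^+ 2.
Proof. by rewrite normrZ exprMn real_normK ?num_real. Qed.

(** The defect term is what makes every multiple of a squared distance
    strongly convex. *)
Lemma sqr_norm_convex (a : K) (q u v : W) :
  `|(a *: u + (1 - a) *: v) - q| ^+ 2 =
  a * `|u - q| ^+ 2 + (1 - a) * `|v - q| ^+ 2 - a * (1 - a) * `|u - v| ^+ 2.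
Proof.
have -> : a *: u + (1 - a) *: v - q = a *: (u - q) + (1 - a) *: (v - q).
  rewrite !scalerBr addrACA -opprD -scalerDl.
  by rewrite [a + _]addrC subrK scale1r.
have -> : u - v = (u - q) - (v - q) by rewrite opprB addrA subrK.
rewrite (sqr_normD (a *: _)) (sqr_normB (u - q)) !sqr_normZ.
rewrite ipZl ipZr; ring.
Qed.

(** Young's inequality, from the sign of |t u - v|^2. *)
Lemma ip_young (t : K) (u v : W) : 0 < t ->
  ip u v <= t / 2 * `|u| ^+ 2 + (2 * t)^-1 * `|v| ^+ 2.
Proof.
move=> t0; have := sqr_ge0 `|t *: u - v|.
rewrite sqr_normB sqr_normZ ipZl => H.
rewrite -subr_ge0.
suff -> : t / 2 * `|u| ^+ 2 + (2 * t)^-1 * `|v| ^+ 2 - ip u v =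
  (2 * t)^-1 * (t ^+ 2 * `|u| ^+ 2 - 2 * (t * ip u v) + `|v| ^+ 2).
  by rewrite mulr_ge0// invr_ge0 mulr_ge0// ltW.
field; exact: lt0r_neq0.
Qed.

End HilbertGeometry.

(** * Minimizers of quadratically regularized convex functions *)

Section Regularized.
Context {K : realType} {W : completeNormedModType K} {ip : {dot W for idfun}}.
Hypothesis ip_norm : induces_norm ip.

Definition regularized (m : K) (q : W) (g : W -> \bar K) (y : W) : \bar K :=
  ((m * `|y - q| ^+ 2)%:E + g y)%E.

Variables (m : K) (q : W) (g : W -> \bar K).
Hypotheses (m_gt0 : 0 < m) (g_convex : econvex g) (g_lsc : lower_semicontinuous g).
Hypothesis g_gtNy : forall v, g v != -oo%E.
Local Notation h := (regularized m q g).

(** Strong convexity, with the value at the intermediate point replaced by any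
    lower bound [c] of the function.  This keeps the inequality between real
    numbers, and both uses below have such a bound: the minimum for the growth
    estimate, a nearly minimal value for the Cauchy estimate. *)
Lemma regularized_strongly_convex (c a r s : K) (u v : W) :
  (forall z, (c%:E <= h z)%E) -> h u = r%:E -> h v = s%:E -> 0 < a < 1 ->
  c + m * (a * (1 - a)) * `|u - v| ^+ 2 <= a * r + (1 - a) * s.
Proof.
move=> c_le; rewrite /regularized => hu hv a01.
have := c_le (a *: u + (1 - a) *: v); rewrite /regularized.
have := g_convex u v a a01.
move: hu hv (g_gtNy (a *: u + (1 - a) *: v)).
case: (g u) => //= ru; case: (g v) => //= rv.
case: (g _) => //= rz.
rewrite -!EFinM -!EFinD !lee_fin => -[<-] [<-] _.
rewrite (sqr_norm_convex ip_norm).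
nra.
Qed.

(** Strong convexity between [u] and the minimizer [v], with weight [a] on [u],
    gives the bound with the factor 1 - a on the left; let a tend to 0. *)
Lemma quadratic_growth (r s : K) (u v : W) :
  is_argmin h v -> h u = r%:E -> h v = s%:E ->
  m * `|u - v| ^+ 2 <= r - s.
Proof.
move=> vmin hu hv.
have s_le z : (s%:E <= h z)%E by rewrite -hv; exact: vmin.
have growth a : 0 < a < 1 -> (1 - a) * (m * `|u - v| ^+ 2) <= r - s.
  move=> a01.
  have := regularized_strongly_convex _ _ _ _ _ _ s_le hu hv a01.
  case/andP: a01 => a0 _ H.
  rewrite -(ler_pM2l a0); lra.
set x := m * _ in growth *.
have x_ge0 : 0 <= x by rewrite mulr_ge0 ?sqr_ge0// ltW.
have half : x <= 2 * (r - s).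
  suff : (1 - 2^-1) * x <= r - s by lra.
  by apply: growth; lra.
rewrite leNgt; apply/negP => lt_x.
have x_gt0 : 0 < x by lra.
(* This weight is at most 1/2 and violates [growth]. *)
pose a := (x - (r - s)) / (2 * x).
have ax : a * x = (x - (r - s)) / 2 by rewrite /a; field; exact: lt0r_neq0.
have a0 : 0 < a by rewrite divr_gt0//; lra.
have a1 : a < 1 by rewrite ltr_pdivrMr; lra.
have := growth a; rewrite a0 a1 => /(_ isT).
rewrite mulrBl ax; lra.
Qed.

Lemma regularized_lsc : lower_semicontinuous h.
Proof.
move=> x a; rewrite /regularized => ax.
set p := m * `|x - q| ^+ 2 in ax.
have [b bg ab] : exists2 b, (b%:E < g x)%E & a - b < p.
  move: ax (g_gtNy x); case: (g x) => [r| |] //=.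
    rewrite -EFinD lte_fin => ax _; exists ((a - p + r) / 2); rewrite ?lte_fin; lra.
  by move=> _ _; exists (a - p + 1); rewrite ?ltry//; lra.
have cont : (m * `|z - q| ^+ 2) @[z --> x] --> p.
  apply: cvgM; first exact: cvg_cst.
  have : `|z - q| @[z --> x] --> `|x - q|.
    apply: cvg_norm; apply: cvgB; [exact: cvg_id|exact: cvg_cst].
  rewrite !expr2 => H.
  under eq_fun do rewrite expr2.
  exact: cvgM.
have [V xV gV] := g_lsc _ _ bg.
exists (V `&` [set z | a - b < m * `|z - q| ^+ 2]).
  apply: filterI => //; exact: (cvgr_gt p).
move=> z [/gV bz /= az].
have := lteD (_ : (a - b)%:E < (m * `|z - q| ^+ 2)%:E)%E bz.
by rewrite lte_fin -EFinD subrK; exact.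
Qed.

(** The midpoint of two nearly minimal points cannot do much better than either
    of them, so strong convexity forces these points to be close. *)
Lemma minimizing_sequence_cauchy (u : nat -> W) (d : nat -> K) :
  (forall j, h (u j) \is a fin_num) ->
  (forall j z, (h (u j) <= h z + (d j)%:E)%E) ->
  d j @[j --> \oo] --> (0 : K) -> cvg (u j @[j --> \oo]).
Proof.
move=> hfin umin d0; apply/cauchy_cvgP/cauchy_exP => e e0.
have lower j z : ((fine (h (u j)) - d j)%:E <= h z)%E.
  by rewrite EFinB (fineK (hfin j)) leeBlDr.
(* Add the midpoint inequalities obtained from the lower bounds given by
   the indices i and j. *)
have close i j : m / 2 * `|u i - u j| ^+ 2 <= d i + d j.
  have H k := regularized_strongly_convex _ (2^-1) _ _ _ _ (lower k)
    (esym (fineK (hfin i))) (esym (fineK (hfin j))).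
  have {H} [Hi Hj] : _ /\ _ := conj (H i ltac:(lra)) (H j ltac:(lra)).
  lra.
have m4 : 0 < m / 4 * e ^+ 2 by rewrite mulr_gt0 ?exprn_gt0 ?divr_gt0.
have [N _ small] : \forall j \near \oo, d j < m / 4 * e ^+ 2.
  exact: (cvgr_lt 0).
exists (u N), N => //= i /small di; rewrite -ball_normE/=.
have dN := small N (leqnn N).
rewrite -(@ltr_pXn2r _ 2)// ?nnegrE ?normr_ge0//; last exact: ltW.
have m2 : 0 < m / 2 by rewrite divr_gt0.
rewrite -(ltr_pM2l m2); apply: le_lt_trans (close _ _) _; lra.
Qed.

(** A value at the limit above some [h z] would, by lower semicontinuity, stay
    above a level strictly larger than [h z] along the sequence. *)
Lemma minimizing_sequence_argmin (u : nat -> W) (d : nat -> K) :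
  (forall j, h (u j) \is a fin_num) ->
  (forall j z, (h (u j) <= h z + (d j)%:E)%E) ->
  d j @[j --> \oo] --> (0 : K) -> is_argmin h (lim (u j @[j --> \oo])).
Proof.
move=> hfin umin d0 z.
have u_cvg := minimizing_sequence_cauchy _ _ hfin umin d0.
rewrite leNgt; apply/negP => hz.
have zfin : h z \is a fin_num.
  rewrite fin_numE (lt_eqF (lt_le_trans hz (leey _))) andbT.
  by rewrite /regularized; move: (g_gtNy z); case: (g z).
have [a za al] : exists2 a : K, (h z < a%:E)%E & (a%:E < h (lim (u j @[j --> \oo])))%E.
  move: hz; rewrite -(fineK zfin); case: (h (lim _)) => [r| |]//=.
    rewrite lte_fin => hz; exists ((fine (h z) + r) / 2); rewrite lte_fin; lra.
  by move=> _; exists (fine (h z) + 1); rewrite ?ltry// lte_fin; lra.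
have [V limV Va] := regularized_lsc _ _ al.
have [j [ajl daj]] : exists j, (a%:E < h (u j))%E /\ d j < a - fine (h z).
  have near_V : \forall j \near \oo, V (u j) by exact: u_cvg.
  have near_d : \forall j \near \oo, d j < a - fine (h z).
    by apply: (cvgr_lt 0) => //; rewrite subr_gt0 -lte_fin fineK.
  have [N _ HN] : \forall j \near \oo, V (u j) /\ d j < a - fine (h z).
    by near=> j; split; near: j.
  by have [/Va ? ?] := HN N (leqnn N); exists N.
have := lt_le_trans ajl (umin j z).
rewrite -(fineK zfin) -EFinD lte_fin; lra.
Unshelve. all: by end_near. Qed.

End Regularized.

(** * The Riesz representation theorem *)

Section Riesz.
Context {K : realType} {W : completeNormedModType K} {ip : {dot W for idfun}}.
Hypothesis ip_norm : induces_norm ip.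
Variable l : dual W.

Local Notation energy := (regularized 2^-1 0 (fun v => (- l v)%:E)).

Lemma opp_dual_convex : econvex (fun v : W => (- l v)%:E).
Proof.
move=> u v a _; rewrite linearD !linearZ/= -!EFinM -EFinD lee_fin.
by rewrite opprD !mulrN.
Qed.

Lemma opp_dual_lsc : lower_semicontinuous (fun v : W => (- l v)%:E).
Proof.
move=> x a; rewrite lte_fin => ax; exists [set z | a < - l z] => //.
by apply: (cvgr_gt (- l x)) ax; apply: cvgN; exact: dual_continuous.
Qed.

Lemma energyE v : energy v = (`|v| ^+ 2 / 2 - l v)%:E.
Proof. by rewrite /regularized subr0 mulrC -EFinD. Qed.

Lemma energy_bounded_below : exists c : K, forall v, c <= `|v| ^+ 2 / 2 - l v.
Proof.
have /(@continuous_linear_bounded _ _ _ 0 l)/linear_boundedP[r0 [_ lr]] :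
  {for 0, continuous l} by exact: dual_continuous.
pose r := r0 + 1; have {}lr v : `|l v| <= r * `|v|.
  by apply: lr; rewrite /r ltrDl.
exists (- (r ^+ 2 / 2)) => v.
have := le_trans (ler_norm _) (lr v).
have := sqr_ge0 (`|v| - r); nra.
Qed.

(** A sequence whose values approach the infimum at rate 1 / (n + 1) is a
    minimizing sequence of the energy. *)
Lemma energy_argmin : exists v, is_argmin energy v.
Proof.
pose E := [set (`|v| ^+ 2 / 2 - l v) | v in [set: W]].
have hasE : has_inf E.
  split; first by exists (`|0 : W| ^+ 2 / 2 - l 0), 0.
  have [c cE] := energy_bounded_below; exists c => _ [v _ <-]; exact: cE.
have near_inf n : exists v : W, `|v| ^+ 2 / 2 - l v < inf E + n.+1%:R^-1.
  have [|_ [v _ <-] Ev] := @inf_adherent _ E n.+1%:R^-1 _ hasE.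
    by rewrite invr_gt0.
  by exists v.
have [u Hu] := choice near_inf.
exists (lim (u j @[j --> \oo])).
apply: (minimizing_sequence_argmin ip_norm _ _ _ _ opp_dual_convex opp_dual_lsc
  _ u (fun j => j.+1%:R^-1)) => //.
- move=> j z; rewrite !energyE -EFinD lee_fin; apply: le_trans (ltW (Hu j)) _.
  rewrite lerD2r; apply: ge_inf; first by case: hasE.
  by exists z.
- exact: cvg_harmonic.
Qed.

(** The minimizer v of |v|^2 / 2 - l v represents l: its first-order condition
    is that (v, u) = l u for every u. *)
Lemma riesz_representation u : ip (riesz_inv ip l) u = l u.
Proof.
move: u; apply: (@xgetPex _ 0 [set v | forall u, ip v u = l u]).
have [v vmin] := energy_argmin; exists v => u /=.
apply/eqP; rewrite -subr_eq0; apply/negPn/negP => d0.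
set d := ip v u - l u in d0.
have first_order a : 0 <= a * d + a ^+ 2 / 2 * `|u| ^+ 2.
  have := vmin (v + a *: u); rewrite !energyE lee_fin.
  have -> : l (v + a *: u) = l v + a * l u by rewrite linearD linearZ.
  rewrite (sqr_normD ip_norm) sqr_normZ ipZr /d; lra.
have N0 : 0 < `|u| ^+ 2 + 1 by have := sqr_ge0 `|u|; lra.
(* This is nearly the minimizer of the quadratic in [first_order]; the added 1
   makes it defined for u = 0 as well. *)
have := first_order (- d / (`|u| ^+ 2 + 1)).
set N := `|u| ^+ 2 in N0 *.
have -> : - d / (N + 1) * d + (- d / (N + 1)) ^+ 2 / 2 * N =
  - (d ^+ 2 / (N + 1) ^+ 2 * (N / 2 + 1)).
  by field; exact: lt0r_neq0.
have N_ge0 : 0 <= N by exact: sqr_ge0.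
rewrite oppr_ge0 leNgt mulr_gt0//; last lra.
by rewrite divr_gt0 ?exprn_even_gt0// (gt_eqF N0).
Qed.

End Riesz.

(** * Weak duality and the primal-dual gap *)

Section Duality.
Context {K : realType} {W X : completeNormedModType K} {ip : {dot W for idfun}}.
Hypothesis ip_norm : induces_norm ip.
Variables (T : bounded_linear W X) (R : X -> \bar K).
Hypothesis R_gtNy : forall x, R x != -oo%E.

Lemma econvex_comp : econvex R -> econvex (R \o T).
Proof. by move=> cR u v a a01 /=; rewrite linearD !linearZ/=; exact: cR. Qed.

Lemma lower_semicontinuous_comp :
  lower_semicontinuous R -> lower_semicontinuous (R \o T).
Proof.
move=> lR x a /lR[V TxV aV]; exists (T @^-1` V); last by move=> z; exact: aV.
exact: (bounded_linear_continuous (bounded_linearP T)).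
Qed.

(** With v representing T^* mu, the Fenchel inequality at T z leaves
    (v, q - z) <= t/2 |v|^2 + |z - q|^2 / (2t) to be shown. *)
Lemma weak_duality (q z : W) (t : K) (mu : dual X) : 0 < t ->
  conjugate R mu \is a fin_num ->
  (dual_objective ip T R q t mu <= primal T R q t z)%E.
Proof.
move=> t0 cfin.
have fenchel : ((mu (T z))%:E - R (T z) <= conjugate R mu)%E.
  by apply: ereal_sup_ubound; exists (T z).
rewrite /dual_objective /primal -(fineK cfin) -EFinB.
move: fenchel (R_gtNy (T z)); rewrite -{1}(fineK cfin).
case: (R (T z)) => [r| |]//=; last by rewrite leey.
rewrite -EFinB -EFinD !lee_fin => fenchel _.
set v := riesz_inv ip (adjoint T mu).
have := ip_young ip_norm t v (q - z) t0.
rewrite (riesz_representation ip_norm) linearB/= distrC.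
rewrite /hdual_norm -/v; lra.
Qed.

Lemma primal_fin_gap (q y : W) (t : K) (mu : dual X) :
  gap ip T R q t y mu \is a fin_num -> primal T R q t y \is a fin_num.
Proof. by rewrite fin_numB => /andP[]. Qed.

(** The gap bounds the suboptimality of y, since the dual objective at mu is
    a lower bound of the primal one at z. *)
Lemma primal_le_gap (q y z : W) (t : K) (mu : dual X) : 0 < t ->
  gap ip T R q t y mu \is a fin_num ->
  (primal T R q t y <= primal T R q t z + gap ip T R q t y mu)%E.
Proof.
move=> t0; rewrite {1}/gap fin_numB => /andP[_ dfin].
have cfin : conjugate R mu \is a fin_num.
  by move: dfin; rewrite fin_numB => /andP[].
have -> : primal T R q t y =
  (dual_objective ip T R q t mu + gap ip T R q t y mu)%E.
  by rewrite addeC subeK.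
by apply: leeD => //; exact: weak_duality.
Qed.

(** Completing the square; the constant does not depend on [s], so both
    problems have the same minimizers up to the shift by [w]. *)
Lemma prox_objectiveE (gradf : W -> W) (w s : W) (t : K) : 0 < t ->
  prox_objective ip gradf (R \o T) w t s =
  (primal T R (w - t *: gradf w)%R t (w + s)%R - (t / 2 * `|gradf w| ^+ 2)%:E)%E.
Proof.
move=> t0; rewrite /prox_objective /primal/= addeAC -EFinB; congr (_%:E + _)%E.
have -> : w + s - (w - t *: gradf w) = s + t *: gradf w.
  by rewrite opprB addrC addrA addrNK addrC.
rewrite (sqr_normD ip_norm) sqr_normZ ipZr (ip_sym s).
by field; exact: lt0r_neq0.
Qed.

End Duality.

(** * Distance of the generated pairs to the proximal step *)

Section ProximalStep.
Context {K : realType} {W X : completeNormedModType K} {ip : {dot W for idfun}}.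
Hypothesis ip_norm : induces_norm ip.
Variables (T : bounded_linear W X) (R : X -> \bar K).
Hypotheses (R_gtNy : forall x, R x != -oo%E) (R_convex : econvex R)
  (R_lsc : lower_semicontinuous R).
Variables (gradf : W -> W) (y : W -> K -> nat -> W)
  (mu : W -> K -> nat -> dual X) (G : W -> K -> nat -> K).
Hypothesis inner : inner_approximation ip T R gradf y mu G.
Variables (w : W) (t : K).
Hypotheses (w_dom : edom (R \o T) w) (t_gt0 : 0 < t).
Local Notation q := (w - t *: gradf w).
Local Notation p := (prox_step ip gradf (R \o T) w t).

Let m_gt0 : 0 < (2 * t)^-1.
Proof. by rewrite invr_gt0 mulr_gt0. Qed.

Let primal_fin j : primal T R q t (y w t j) \is a fin_num.
Proof. by have [/(_ j)/primal_fin_gap] := inner w t w_dom t_gt0. Qed.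

Let primal_le j z :
  (primal T R q t (y w t j) <= primal T R q t z + (G w t j)%:E)%E.
Proof.
have [gap_fin _ gap_le _] := inner w t w_dom t_gt0.
have := primal_le_gap ip_norm _ _ R_gtNy _ _ z _ _ t_gt0 (gap_fin j).
by move=> /le_trans; apply; exact: leeD.
Qed.

(** The limit of the generated points witnesses that a minimizer exists, so that
    [prox_step] is a genuine minimizer and not a default value. *)
Lemma prox_step_argmin : is_argmin (primal T R q t) (w + p).
Proof.
have [_ _ _ G0] := inner w t w_dom t_gt0.
have ymin : is_argmin (primal T R q t) (lim (y w t j @[j --> \oo])).
  exact: (minimizing_sequence_argmin ip_norm _ _ _ m_gt0
    (econvex_comp _ _ R_convex) (lower_semicontinuous_comp _ _ R_lsc)
    (fun v => R_gtNy (T v)) (y w t) (G w t) primal_fin primal_le G0).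
have pmin : is_argmin (prox_objective ip gradf (R \o T) w t) p.
  apply: (@xgetPex _ 0 [set s | is_argmin _ s]).
  exists (lim (y w t j @[j --> \oo]) - w) => s.
  rewrite !(prox_objectiveE ip_norm)// leeD2r// subrKC; exact: ymin.
move=> z; have := pmin (z - w).
by rewrite !(prox_objectiveE ip_norm)// leeD2rE// subrKC.
Qed.

(** Quadratic growth bounds the distance to the minimizer by the suboptimality,
    which weak duality bounds by the gap. *)
Lemma gap_error_bound j : `|y w t j - (w + p)| ^+ 2 <= 2 * t * G w t j.
Proof.
have fin : primal T R q t (w + p) \is a fin_num.
  rewrite fin_numE; apply/andP; split.
    by rewrite /primal; move: (R_gtNy (T (w + p))); case: (R _).
  apply/negP => /eqP pinf; have := prox_step_argmin (y w t j).
  by rewrite pinf leye_eq => /eqP E; move: (primal_fin j); rewrite E.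
have := quadratic_growth ip_norm _ _ _ m_gt0 (econvex_comp T _ R_convex)
    (fun v => R_gtNy (T v)) _ _ _ _ prox_step_argmin
    (esym (fineK (primal_fin j))) (esym (fineK fin)).
have := primal_le j (w + p).
rewrite -{1}(fineK (primal_fin j)) -{1}(fineK fin) -EFinD lee_fin => H1 H2.
rewrite -ler_pdivrMl ?mulr_gt0//; apply: le_trans H2 _; lra.
Qed.

Lemma step_length_error j :
  `| `|y w t j - w| - `|p| | <= Num.sqrt (2 * t * G w t j).
Proof.
apply: le_trans (ler_dist_dist _ _) _.
rewrite -addrA -opprD -[leLHS]normr_id -sqrtr_sqr.
exact/ler_wsqrtr/gap_error_bound.
Qed.

Lemma gap_bound_small e : 0 < e -> exists j, G w t j < e.
Proof.
move=> e0; have [_ _ _ G0] := inner w t w_dom t_gt0.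
have [N _ HN] : \forall j \near \oo, G w t j < e by exact: (cvgr_lt 0).
by exists N; apply: HN => /=.
Qed.

Lemma step_length_error_small e : 0 < e ->
  exists2 j, 2 * t * G w t j <= e ^+ 2 & `| `|y w t j - w| - `|p| | <= e.
Proof.
move=> e0; have t2 : 0 < 2 * t by rewrite mulr_gt0.
have [j Gj] := gap_bound_small _ (divr_gt0 (exprn_gt0 2 e0) t2).
have {}Gj : 2 * t * G w t j <= e ^+ 2.
  by rewrite -ler_pdivlMl// mulrC ltW.
exists j => //; apply: le_trans (step_length_error j) _.
by rewrite -(ger0_norm (ltW e0)) -sqrtr_sqr ler_wsqrtr.
Qed.

(** Once the error is at most sigma |p| / 2 <= |p| / 2, the tested length
    |y^j - w| is at least |p| / 2, which is enough for the relative test. *)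
Lemma relative_test_succeeds (sigma : K) : 0 < sigma -> sigma < 1 -> p != 0 ->
  exists j, relative_test sigma t w (y w t j) (G w t j).
Proof.
move=> s0 s1 p0; have p_gt0 : 0 < `|p| by rewrite normr_gt0.
have e0 : 0 < sigma * `|p| / 2 by rewrite divr_gt0 ?mulr_gt0.
have [j Gj dj] := step_length_error_small _ e0.
exists j; rewrite /relative_test.
have t2 : 0 < 2 * t by rewrite mulr_gt0.
rewrite mulrAC ler_pdivlMr// mulrC; apply: le_trans Gj _.
rewrite -exprMn ler_sqr ?nnegrE; last 2 first.
- exact: ltW.
- by rewrite mulr_ge0// ltW.
rewrite -mulrA ler_pM2l//.
move: dj; rewrite ler_norml => /andP[dj _].
have : sigma * `|p| <= `|p| by rewrite ler_piMl ?ltW.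
lra.
Qed.

End ProximalStep.

(** * The stationarity tests *)

Section Tests.
Context {K : realType} {W : completeNormedModType K}.

Lemma sqrt_step_scale (tau G : K) : 0 < tau ->
  Num.sqrt (2 * G / tau) = Num.sqrt (2 * tau * G) / tau.
Proof.
move=> tau0.
have -> : 2 * G / tau = tau^-1 ^+ 2 * (2 * tau * G).
  by field; exact: lt0r_neq0.
rewrite sqrtrM ?sqr_ge0// sqrtr_sqr ger0_norm ?invr_ge0 ?(ltW tau0)//.
by rewrite mulrC.
Qed.

Lemma run_stops (tau sigma eps : K) (w : W) (y : nat -> W) (G : nat -> K) :
  (exists j, test_pair tau sigma eps w (y j) (G j) <> Continue) ->
  exists j, stops_first tau sigma eps w y G j \/
            stops_second tau sigma eps w y G j.
Proof.
pose stops j := if test_pair tau sigma eps w (y j) (G j) is Continue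
  then false else true.
have stopsP j : ~~ stops j -> test_pair tau sigma eps w (y j) (G j) = Continue.
  by rewrite /stops; case: test_pair.
move=> [j0 stop0]; have exj : exists j, stops j.
  by exists j0; rewrite /stops; case: test_pair stop0.
case: (ex_minnP exj) => j stopj minj; exists j.
have before : continues_before tau sigma eps w y G j.
  by move=> i ij; apply/stopsP/negP => /minj; rewrite leqNgt ij.
by move: stopj; rewrite /stops /stops_first /stops_second; case: test_pair; auto.
Qed.

End Tests.

Theorem proposition3p8 (K : realType) (W X : completeNormedModType K)
    (ip : {dot W for idfun}) (ip_norm : induces_norm ip)
    (T : bounded_linear W X) (R : X -> \bar K)
    (R_proper : eproper R) (R_convex : econvex R)
    (R_lsc : lower_semicontinuous R) (dom_phi : edom (R \o T) !=set0)
    (f : W -> K^o) (gradf : W -> W) (Lf : K)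
    (f_C1 : continuously_differentiable f) (f_grad : is_gradient ip f gradf)
    (Lf_ge0 : 0 <= Lf) (gradf_lip : Lf.-lipschitz gradf)
    (Flow : K)
    (F_bounded : forall w, edom (R \o T) w ->
       (Flow%:E <= (f w)%:E + (R \o T) w)%E)
    (tau sigma : K) (tau_gt0 : 0 < tau) (sigma_gt0 : 0 < sigma)
    (sigma_lt1 : sigma < 1)
    (y : W -> K -> nat -> W) (mu : W -> K -> nat -> dual X)
    (G : W -> K -> nat -> K)
    (inner : inner_approximation ip T R gradf y mu G)
    (w : W) (w_dom : edom (R \o T) w) (eps : K) (eps_gt0 : 0 < eps) :
  [/\ exists j, stops_first tau sigma eps w (y w tau) (G w tau) j \/
                stops_second tau sigma eps w (y w tau) (G w tau) j,
      forall j, stops_first tau sigma eps w (y w tau) (G w tau) j ->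
        chi ip gradf (R \o T) tau w <= eps,
      0 < c_sigma sigma /\
      (forall j, stops_second tau sigma eps w (y w tau) (G w tau) j ->
        c_sigma sigma * eps < chi ip gradf (R \o T) tau w) &
      forall t, 0 < t -> prox_step ip gradf (R \o T) w t != 0 ->
        exists j, relative_test sigma t w (y w t j) (G w t j)].
Proof.
have R_gtNy x : R x != -oo%E by case: R_proper.
set p := prox_step ip gradf (R \o T) w tau.
have err j := step_length_error ip_norm _ _ R_gtNy R_convex R_lsc _ _ _ _ inner
  _ _ w_dom tau_gt0 j.
split.
- apply: run_stops; have [p0|p_neq0] := eqVneq p 0.
    (* Half of the tolerance for each of the two terms of the first test. *)
    have e0 : 0 < eps * tau / 2 by rewrite divr_gt0 ?mulr_gt0.
    have [j Gj] := step_length_error_small ip_norm _ _ R_gtNy R_convex R_lsc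
      _ _ _ _ inner _ _ w_dom tau_gt0 _ e0.
    rewrite -/p p0 normr0 subr0 normr_id => yj.
    exists j; rewrite /test_pair ifT// /stationarity_bound.
    rewrite sqrt_step_scale// -mulrDl ler_pdivrMr//.
    have sj : Num.sqrt (2 * tau * G w tau j) <= eps * tau / 2.
      by rewrite -(ger0_norm (ltW e0)) -sqrtr_sqr ler_wsqrtr.
    lra.
  have [j relj] := relative_test_succeeds ip_norm _ _ R_gtNy R_convex R_lsc
    _ _ _ _ inner _ _ w_dom tau_gt0 _ sigma_gt0 sigma_lt1 p_neq0.
  by exists j; rewrite /test_pair relj; case: ifP.
- move=> j [_]; rewrite /test_pair; case: ifP; last by case: ifP.
  move=> first_ok _; apply: le_trans first_ok.
  rewrite /chi /stationarity_bound sqrt_step_scale// -mulrDl mulrC.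
  rewrite ler_pM2r ?invr_gt0//.
  have := err j; rewrite ler_norml => /andP[? _]; lra.
- split; first by rewrite divr_gt0// ?subr_gt0// addr_gt0.
  move=> j [_]; rewrite /test_pair; case: ifP => // /negbT.
  rewrite -ltNge => eps_lt; case: ifP => // rel_ok _.
  have sqrt_le : Num.sqrt (2 * tau * G w tau j) <= sigma * `|y w tau j - w|.
    rewrite -[leRHS]ger0_norm ?mulr_ge0 ?(ltW sigma_gt0)// -sqrtr_sqr.
    rewrite ler_wsqrtr// exprMn; move: rel_ok; rewrite /relative_test.
    by rewrite mulrAC ler_pdivlMr ?mulr_gt0// [G w tau j * _]mulrC.
  move: eps_lt; rewrite /stationarity_bound sqrt_step_scale// -mulrDl.
  rewrite ltr_pdivlMr// => eps_lt.
  have := err j; rewrite ler_norml -/p => /andP[_ err_j].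
  have p_ge : (1 - sigma) * `|y w tau j - w| <= `|p| by lra.
  have eps_lt' : eps * tau < (1 + sigma) * `|y w tau j - w| by lra.
  rewrite /chi -/p /c_sigma ltr_pdivlMl//.
  have -> : tau * ((1 - sigma) / (1 + sigma) * eps) =
      (1 - sigma) * (eps * tau) / (1 + sigma) by ring.
  have sigma1 : 0 < 1 + sigma by rewrite addr_gt0.
  rewrite ltr_pdivrMr//.
  have : (1 - sigma) * (eps * tau) <
      (1 - sigma) * ((1 + sigma) * `|y w tau j - w|).
    by rewrite ltr_pM2l// subr_gt0.
  move/lt_le_trans; apply.
  by rewrite mulrCA mulrC ler_pM2r.
- by move=> t t_gt0; exact: (relative_test_succeeds ip_norm _ _ R_gtNy R_convex
    R_lsc _ _ _ _ inner _ _ w_dom t_gt0).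
Qed.
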